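(* Let $I_1,I_2$ be fractional $\mathbb{Z}\langle G\rangle$-ideals and $w_1,w_2\in\mathbb{Q}\langle G\rangle$ such that $I_1\overline{I_1}\subset\mathbb{Z}\langle G\rangle\cdot w_1$, $I_2\overline{I_2}\subset\mathbb{Z}\langle G\rangle\cdot w_2$, and $\psi(w_1),\psi(w_2)\in\mathbb{R}_{>0}$ for all $\psi\in\Psi$. Let $L_j=L_{(I_j,w_j)}$ for $j=1,2$. Then sending $v$ to multiplication by $v$ gives a bijection from $\{v\in\mathbb{Q}\langle G\rangle: I_1=vI_2,\ w_1=v\bar v w_2\}$ to the set of $G$-isomorphisms $L_2\to L_1$, and gives a bijection from $\{v\in\mathbb{Q}\langle G\rangle: I_1=v\mathbb{Z}\langle G\rangle,\ w_1=v\bar v\}$ to the set of $G$-isomorphisms $\mathbb{Z}\langle G\rangle\to L_1$. In particular, $L_1$ is $G$-isomorphic to $\mathbb{Z}\langle G\rangle$ if and only if there exists $v\in\mathbb{Q}\langle G\rangle$ with $I_1=(v)$ and $w_1=v\bar v$.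
   Context: Let $G$ be a finite abelian group with a fixed element $u$ of order $2$. For a commutative ring $A$, $A\langle G\rangle=A[G]/(u+1)$; the scaled trace $t(\sum a_\sigma\sigma)=a_1-a_u$; the involution $\overline{\sum a_\sigma\sigma}=\sum a_\sigma\sigma^{-1}$. $\Psi$ is the set of ring homomorphisms $\mathbb{Q}\langle G\rangle\to\mathbb{C}$. A fractional $\mathbb{Z}\langle G\rangle$-ideal is a finitely generated $\mathbb{Z}\langle G\rangle$-submodule of $\mathbb{Q}\langle G\rangle$ spanning $\mathbb{Q}\langle G\rangle$ over $\mathbb{Q}$. A lattice is a finitely generated abelian group with a bilinear symmetric positive definite $\mathbb{Z}$-valued form; a $G$-lattice is a lattice with a homomorphism from $G$ into its form-preserving automorphisms in which $u$ acts as $-1$; a $G$-isomorphism is a form-preserving group isomorphism commuting with the $G$-actions. For $I$ a fractional ideal and $w$ with $I\bar I\subset\mathbb{Z}\langle G\rangle w$ and $\psi(w)\in\mathbb{R}_{>0}$ for all $\psi\in\Psi$ (then $w$ is invertible), $L_{(I,w)}$ denotes the $G$-lattice $I$ with $G$ acting by multiplication and inner product $\langle x,y\rangle_{I,w}=t(x\bar y/w)$. The standard $G$-lattice $\mathbb{Z}\langle G\rangle$ is $L_{(\mathbb{Z}\langle G\rangle,1)}$. *)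

(* Defs.v *)
From HB Require Import structures.
From mathcomp Require Import all_boot all_order all_algebra all_fingroup.
From mathcomp Require Import all_solvable all_field all_character.
From mathcomp Require Import generic_quotient ring_quotient.
From mathcomp Require Import ring.
From mathcomp Require Import boolp classical_sets functions reals complex.

Set Implicit Arguments.
Unset Strict Implicit.
Unset Printing Implicit Defensive.

Import Order.TTheory GRing.Theory Num.Theory.
Local Open Scope ring_scope.
Local Open Scope quotient_scope.

(* Finite abelian groups are finZmodTypes, hence written additively: the unit
   is 0 and the inverse of g is - g.

   A[G]: finitely supported functions with the convolution product.  This is a
   fresh name for {ffun G -> A} because the latter carries the pointwise
   product. *)
Definition grpalg (A : comNzRingType) (G : finZmodType) : Type := {ffun G -> A}.

Section GroupAlgebra.
Variables (A : comNzRingType) (G : finZmodType).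
Local Notation AG := (grpalg A G).

HB.instance Definition _ := GRing.Lmodule.copy AG {ffun G -> A^o}.

Definition ga_coef (a : AG) (g : G) : A := (a : {ffun G -> A}) g.
Definition ga_make (f : G -> A) : AG := [ffun g => f g].

Lemma ga_makeE f g : ga_coef (ga_make f) g = f g.
Proof. by rewrite /ga_coef ffunE. Qed.
Lemma ga_eqP (a b : AG) : (forall g, ga_coef a g = ga_coef b g) -> a = b.
Proof. by move=> H; apply/ffunP => g; apply: H. Qed.
Lemma ga_coefD (a b : AG) g : ga_coef (a + b) g = ga_coef a g + ga_coef b g.
Proof. by rewrite /ga_coef [LHS]ffunE. Qed.
Lemma ga_coef0 g : ga_coef (0 : AG) g = 0.
Proof. by rewrite /ga_coef [LHS]ffunE. Qed.
Lemma ga_coefN (a : AG) g : ga_coef (- a) g = - ga_coef a g.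
Proof. by rewrite /ga_coef [LHS]ffunE. Qed.
Lemma ga_coefZ c (a : AG) g : ga_coef (c *: a) g = c * ga_coef a g.
Proof. by rewrite /ga_coef [LHS]ffunE. Qed.

Definition ga_of (g : G) : AG := ga_make (fun h => (h == g)%:R).
Definition ga_mul (a b : AG) : AG :=
  ga_make (fun g => \sum_h ga_coef a h * ga_coef b (g - h)).

Lemma ga_mulA : associative ga_mul.
Proof.
move=> a b c; apply: ga_eqP => g; rewrite !ga_makeE.
under eq_bigr do rewrite ga_makeE mulr_sumr.
under [RHS]eq_bigr do rewrite ga_makeE mulr_suml.
rewrite [RHS]exchange_big /=; apply: eq_bigr => h _.
rewrite [RHS](reindex_inj (addIr h)) /=; apply: eq_bigr => k _.
by rewrite addrK mulrA opprD [- k - h]addrC addrA.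
Qed.
Lemma ga_mulC : commutative ga_mul.
Proof.
move=> a b; apply: ga_eqP => g; rewrite !ga_makeE.
rewrite [RHS](reindex_inj (inv_inj (subKr g))) /=.
by apply: eq_bigr => h _; rewrite mulrC subKr.
Qed.
Lemma ga_ofM_coef g (b : AG) h : ga_coef (ga_mul (ga_of g) b) h = ga_coef b (h - g).
Proof.
rewrite ga_makeE (bigD1 g) //= ga_makeE eqxx mul1r big1 ?addr0 // => k nk.
by rewrite ga_makeE (negPf nk) mul0r.
Qed.
Lemma ga_mul1 : left_id (ga_of 0) ga_mul.
Proof. by move=> a; apply: ga_eqP => g; rewrite ga_ofM_coef subr0. Qed.
Lemma ga_mulD : left_distributive ga_mul +%R.
Proof.
move=> a b c; apply: ga_eqP => g; rewrite ga_coefD !ga_makeE -big_split /=.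
by apply: eq_bigr => h _; rewrite ga_coefD mulrDl.
Qed.
Lemma ga_1neq0 : ga_of 0 != 0.
Proof.
apply/eqP => /(congr1 (fun a => ga_coef a 0)).
by rewrite ga_makeE eqxx ga_coef0; apply/eqP; rewrite oner_eq0.
Qed.

HB.instance Definition _ := GRing.Zmodule_isComNzRing.Build AG
  ga_mulA ga_mulC ga_mul1 ga_mulD ga_1neq0.

Lemma ga_scaleAl c (a b : AG) : c *: (a * b) = c *: a * b.
Proof.
apply: ga_eqP => g; rewrite ga_coefZ !ga_makeE mulr_sumr.
by apply: eq_bigr => h _; rewrite ga_coefZ mulrA.
Qed.
HB.instance Definition _ := GRing.Lmodule_isLalgebra.Build A AG ga_scaleAl.

Lemma ga_coefM (a b : AG) g :
  ga_coef (a * b) g = \sum_h ga_coef a h * ga_coef b (g - h).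
Proof. exact: ga_makeE. Qed.
Lemma ga_of0 : ga_of 0 = 1. Proof. by []. Qed.
Lemma ga_of_mulE g (b : AG) h : ga_coef (ga_of g * b) h = ga_coef b (h - g).
Proof. exact: ga_ofM_coef. Qed.
Lemma ga_ofD g h : ga_of (g + h) = ga_of g * ga_of h.
Proof.
by apply: ga_eqP => k; rewrite ga_of_mulE !ga_makeE subr_eq [h + g]addrC.
Qed.
Lemma ga_coef_sum I (r : seq I) (P : pred I) (F : I -> AG) g :
  ga_coef (\sum_(i <- r | P i) F i) g = \sum_(i <- r | P i) ga_coef (F i) g.
Proof.
by elim/big_rec2: _ => [|i x y _ <-]; rewrite ?ga_coef0 ?ga_coefD.
Qed.
Lemma ga_decomp (a : AG) : a = \sum_g ga_coef a g *: ga_of g.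
Proof.
apply: ga_eqP => g; rewrite ga_coef_sum (bigD1 g) //= big1 => [|h nh].
  by rewrite ga_coefZ ga_makeE eqxx mulr1 addr0.
by rewrite ga_coefZ ga_makeE eq_sym (negPf nh) mulr0.
Qed.

End GroupAlgebra.

Section Quotient.
Variables (A : comNzRingType) (G : finZmodType) (u : G).
Hypothesis hu : #[u]%g = 2%N.
Local Notation AG := (grpalg A G).

Lemma order2P : (u != 0) /\ (u + u = 0).
Proof.
split; last by have := expg_order u; rewrite hu.
by apply/eqP => u0; move: hu; rewrite u0 (_ : (0 : G) = 1%g) // order1.
Qed.
Lemma oppu : - u = u.
Proof. by apply/esym/eqP; rewrite -addr_eq0; case: order2P => _ ->. Qed.

(* The ideal (u + 1).  The proof that u has order 2 is an argument only because
   quotients are defined for proper ideals. *)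
Definition upideal of (#[u]%g = 2%N) : {pred AG} :=
  fun x => `[< exists y : AG, x = y * (ga_of A u + 1) >].

Lemma upidealP (x : AG) :
  reflect (exists y : AG, x = y * (ga_of A u + 1)) (x \in upideal hu).
Proof. exact: asboolP. Qed.

Lemma upideal_coef (x : AG) : x \in upideal hu ->
  forall g, ga_coef x (g + u) = ga_coef x g.
Proof.
move=> /upidealP[y ->] g; rewrite mulrC mulrDl mul1r !ga_coefD !ga_of_mulE.
by rewrite addrK oppu addrC.
Qed.

Fact upideal_idealr : idealr_closed (upideal hu).
Proof.
split.
- by apply/upidealP; exists 0; rewrite mul0r.
- apply/negP => /upideal_coef /(_ 0); rewrite add0r !ga_makeE eqxx.
  case: order2P => /negPf -> _ /esym /eqP; by rewrite oner_eq0.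
- move=> a x y /upidealP[x' ->] /upidealP[y' ->]; apply/upidealP.
  by exists (a * x' + y'); rewrite mulrDl mulrA.
Qed.
HB.instance Definition _ := isIdealr.Build AG (upideal hu) upideal_idealr.

(* A<G>. *)
Definition grpmod : Type := {ideal_quot (upideal hu)}.
HB.instance Definition _ := GRing.ComNzRing.copy grpmod {ideal_quot (upideal hu)}.

Definition gm_pi (a : AG) : grpmod := \pi_({ideal_quot (upideal hu)}) a.
Definition gm_repr (x : grpmod) : AG := repr (x : {ideal_quot (upideal hu)}).

Lemma gm_reprK : cancel gm_repr gm_pi.
Proof. exact: reprK. Qed.
Lemma gm_pi_eq (a b : AG) : gm_pi a = gm_pi b <-> a - b \in upideal hu.
Proof.
by rewrite Quotient.idealrBE; split => /eqP.
Qed.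
Lemma gm_repr_pi (a : AG) : gm_repr (gm_pi a) - a \in upideal hu.
Proof. by apply/gm_pi_eq; rewrite gm_reprK. Qed.
Lemma gm_piB : zmod_morphism gm_pi.
Proof. by move=> a b; rewrite /gm_pi rmorphB. Qed.
Lemma gm_piM : monoid_morphism gm_pi.
Proof. by split=> [|a b]; rewrite /gm_pi ?rmorph1 ?rmorphM. Qed.
HB.instance Definition _ := GRing.isZmodMorphism.Build AG grpmod gm_pi gm_piB.
HB.instance Definition _ := GRing.isMonoidMorphism.Build AG grpmod gm_pi gm_piM.

Definition gm_scale (c : A) (x : grpmod) : grpmod := gm_pi (c *: 1) * x.
Fact gm_scaleA a b v : gm_scale a (gm_scale b v) = gm_scale (a * b) v.
Proof. by rewrite /gm_scale mulrA -rmorphM mulr_algl scalerA. Qed.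
Fact gm_scale1 : left_id 1 gm_scale.
Proof. by move=> x; rewrite /gm_scale scale1r rmorph1 mul1r. Qed.
Fact gm_scaleDr : right_distributive gm_scale +%R.
Proof. by move=> c x y; rewrite /gm_scale mulrDr. Qed.
Fact gm_scaleDl v : {morph gm_scale^~ v : a b / a + b}.
Proof. by move=> a b; rewrite /gm_scale scalerDl rmorphD mulrDl. Qed.
HB.instance Definition _ := GRing.Zmodule_isLmodule.Build A grpmod
  gm_scaleA gm_scale1 gm_scaleDr gm_scaleDl.
Fact gm_scaleAl (a : A) (x y : grpmod) : a *: (x * y) = a *: x * y.
Proof. exact: mulrA. Qed.
HB.instance Definition _ := GRing.Lmodule_isLalgebra.Build A grpmod gm_scaleAl.
Fact gm_scaleAr (a : A) (x y : grpmod) : a *: (x * y) = x * (a *: y).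
Proof. by rewrite mulrC gm_scaleAl mulrC. Qed.
HB.instance Definition _ := GRing.Lalgebra_isAlgebra.Build A grpmod gm_scaleAr.

Lemma gm_piZ c (a : AG) : gm_pi (c *: a) = c *: gm_pi a.
Proof. by rewrite -[c *: a]mulr_algl rmorphM. Qed.

Definition gm_unit : pred grpmod := fun x => `[< exists y, y * x = 1 >].
Definition gm_inv (x : grpmod) : grpmod :=
  if pselect (exists y, y * x = 1) is left h then projT1 (cid h) else x.
Fact gm_mulVx : {in gm_unit, left_inverse 1 gm_inv *%R}.
Proof.
move=> x /asboolP h; rewrite /gm_inv.
by case: pselect => // h'; case: (cid h').
Qed.
Fact gm_unitPl (x y : grpmod) : y * x = 1 -> gm_unit x.
Proof. by move=> h; apply/asboolP; exists y. Qed.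
Fact gm_inv_out : {in [predC gm_unit], gm_inv =1 id}.
Proof. by move=> x /asboolPn h; rewrite /gm_inv; case: pselect. Qed.
HB.instance Definition _ := GRing.ComNzRing_hasMulInverse.Build grpmod
  gm_mulVx gm_unitPl gm_inv_out.

Definition gm_of (g : G) : grpmod := gm_pi (ga_of A g).
Lemma gm_of0 : gm_of 0 = 1.
Proof. by rewrite /gm_of ga_of0 rmorph1. Qed.
Lemma gm_ofD g h : gm_of (g + h) = gm_of g * gm_of h.
Proof. by rewrite /gm_of ga_ofD rmorphM. Qed.
Lemma gm_ofu : gm_of u = - 1.
Proof.
apply/eqP; rewrite -subr_eq0 opprK -gm_of0 -rmorphD; apply/eqP.
rewrite -(rmorph0 gm_pi); apply/gm_pi_eq; rewrite subr0 ga_of0.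
by apply/upidealP; exists 1; rewrite mul1r.
Qed.

Lemma gm_lift (S : pzRingType) (F : {rmorphism AG -> S}) (a : AG) :
  F (ga_of A u) = -1 -> F (gm_repr (gm_pi a)) = F a.
Proof.
move=> Fu; apply/eqP; rewrite -subr_eq0 -rmorphB.
by case/upidealP: (gm_repr_pi a) => y ->; rewrite rmorphM rmorphD Fu rmorph1 addNr mulr0.
Qed.

(* The scaled trace, read off on any representative (gm_tr_pi). *)
Definition gm_tr (x : grpmod) : A := ga_coef (gm_repr x) 0 - ga_coef (gm_repr x) u.

Lemma gm_tr_pi (a : AG) : gm_tr (gm_pi a) = ga_coef a 0 - ga_coef a u.
Proof.
rewrite /gm_tr; have := upideal_coef (gm_repr_pi a) 0.
rewrite add0r !ga_coefD !ga_coefN => /eqP; rewrite subr_eq => /eqP ->.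
by ring.
Qed.
Lemma gm_trB : zmod_morphism gm_tr.
Proof.
move=> x y; rewrite -[x]gm_reprK -[y]gm_reprK -rmorphB !gm_tr_pi.
by rewrite !ga_coefD !ga_coefN !opprD !opprK addrACA.
Qed.
HB.instance Definition _ := GRing.isZmodMorphism.Build grpmod A gm_tr gm_trB.

(* The involution, computed on any representative (gm_bar_pi). *)
Definition ga_bar (a : AG) : AG := ga_make (fun g => ga_coef a (- g)).
Definition gm_bar (x : grpmod) : grpmod := gm_pi (ga_bar (gm_repr x)).

Lemma ga_barE a g : ga_coef (ga_bar a) g = ga_coef a (- g).
Proof. exact: ga_makeE. Qed.
Lemma ga_barB : zmod_morphism ga_bar.
Proof.
by move=> a b; apply: ga_eqP => g; rewrite !(ga_coefD, ga_coefN, ga_barE).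
Qed.
Lemma ga_barM : monoid_morphism ga_bar.
Proof.
split=> [|a b]; apply: ga_eqP => g.
  by rewrite !ga_makeE oppr_eq0.
rewrite ga_barE !ga_coefM (reindex_inj oppr_inj) /=.
by apply: eq_bigr => h _; rewrite !ga_barE -opprD.
Qed.
HB.instance Definition _ := GRing.isZmodMorphism.Build AG AG ga_bar ga_barB.
HB.instance Definition _ := GRing.isMonoidMorphism.Build AG AG ga_bar ga_barM.
Lemma ga_bar_of g : ga_bar (ga_of A g) = ga_of A (- g).
Proof. by apply: ga_eqP => h; rewrite !ga_makeE eqr_oppLR. Qed.
Lemma gm_bar_pi a : gm_bar (gm_pi a) = gm_pi (ga_bar a).
Proof.
have := @gm_lift _ (gm_pi \o ga_bar) a; apply => /=.
by rewrite ga_bar_of oppu -[gm_pi _]/(gm_of u) gm_ofu.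
Qed.
Lemma gm_barB : zmod_morphism gm_bar.
Proof.
by move=> x y; rewrite -[x]gm_reprK -[y]gm_reprK -rmorphB !gm_bar_pi !rmorphB.
Qed.
Lemma gm_barM : monoid_morphism gm_bar.
Proof.
split=> [|x y]; first by rewrite -(rmorph1 gm_pi) gm_bar_pi !rmorph1.
by rewrite -[x]gm_reprK -[y]gm_reprK -rmorphM !gm_bar_pi !rmorphM.
Qed.
HB.instance Definition _ := GRing.isZmodMorphism.Build grpmod grpmod gm_bar gm_barB.
HB.instance Definition _ := GRing.isMonoidMorphism.Build grpmod grpmod gm_bar gm_barM.
Lemma gm_barK : involutive gm_bar.
Proof.
move=> x; rewrite -[x]gm_reprK !gm_bar_pi; congr gm_pi.
by apply: ga_eqP => g; rewrite !ga_makeE opprK.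
Qed.
Lemma gm_bar_of g : gm_bar (gm_of g) = gm_of (- g).
Proof. by rewrite gm_bar_pi ga_bar_of. Qed.
Lemma gm_tr_bar x : gm_tr (gm_bar x) = gm_tr x.
Proof.
by rewrite -[x]gm_reprK gm_bar_pi !gm_tr_pi !ga_makeE oppr0 oppu.
Qed.
Lemma gm_decomp x : x = \sum_g ga_coef (gm_repr x) g *: gm_of g.
Proof.
rewrite -[LHS]gm_reprK {1}[gm_repr x]ga_decomp raddf_sum.
by apply: eq_bigr => g _; rewrite /= gm_piZ.
Qed.
Lemma gm_tr_of_mul g a : gm_tr (gm_of (- g) * gm_pi a) = ga_coef a g - ga_coef a (g + u).
Proof.
by rewrite -rmorphM gm_tr_pi !ga_of_mulE opprK add0r [u + g]addrC.
Qed.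
Lemma gm_tr_nondeg x : (forall g, gm_tr (gm_of g * x) = 0) -> 2%:R \is a @GRing.unit grpmod -> x = 0.
Proof.
move=> h u2; suff: x *+ 2 = 0.
  by move=> /eqP; rewrite -mulr_natr => /eqP h2; rewrite -[x](mulrK u2) h2 mul0r.
have hx : forall g, ga_coef (gm_repr x) g = ga_coef (gm_repr x) (g + u).
  by move=> g; apply/eqP; rewrite -subr_eq0 -gm_tr_of_mul gm_reprK h.
suff xx : x = - x by rewrite mulr2n {2}xx subrr.
rewrite -mulN1r -gm_ofu -{1 2}[x]gm_reprK -rmorphM; congr gm_pi.
by apply: ga_eqP => g; rewrite ga_of_mulE oppu.
Qed.

End Quotient.

Section BaseChange.
Variables (A B : comNzRingType) (f : {rmorphism A -> B}).
Variables (G : finZmodType) (u : G) (hu : #[u]%g = 2%N).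

Definition ga_map (a : grpalg A G) : grpalg B G := ga_make (fun g => f (ga_coef a g)).
Lemma ga_mapE a g : ga_coef (ga_map a) g = f (ga_coef a g).
Proof. exact: ga_makeE. Qed.
Lemma ga_mapB : zmod_morphism ga_map.
Proof.
by move=> a b; apply: ga_eqP => g; rewrite !(ga_coefD, ga_coefN, ga_mapE) rmorphB.
Qed.
Lemma ga_mapM : monoid_morphism ga_map.
Proof.
split=> [|a b]; apply: ga_eqP => g; first by rewrite !ga_makeE rmorph_nat.
rewrite ga_mapE !ga_coefM rmorph_sum.
by apply: eq_bigr => h _; rewrite !ga_mapE rmorphM.
Qed.
HB.instance Definition _ := GRing.isZmodMorphism.Build _ _ ga_map ga_mapB.
HB.instance Definition _ := GRing.isMonoidMorphism.Build _ _ ga_map ga_mapM.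
Lemma ga_map_of g : ga_map (ga_of A g) = ga_of B g.
Proof. by apply: ga_eqP => h; rewrite !ga_makeE rmorph_nat. Qed.

Definition gm_map (x : grpmod A hu) : grpmod B hu := gm_pi hu (ga_map (gm_repr x)).
Lemma gm_map_pi a : gm_map (gm_pi hu a) = gm_pi hu (ga_map a).
Proof.
have := @gm_lift _ _ _ hu _ (gm_pi hu \o ga_map) a; apply => /=.
by rewrite ga_map_of -[gm_pi _ _]/(gm_of B hu u) gm_ofu.
Qed.
Lemma gm_mapB : zmod_morphism gm_map.
Proof.
by move=> x y; rewrite -[x]gm_reprK -[y]gm_reprK -rmorphB !gm_map_pi !rmorphB.
Qed.
Lemma gm_mapM : monoid_morphism gm_map.
Proof.
split=> [|x y]; first by rewrite -(rmorph1 (gm_pi hu)) gm_map_pi !rmorph1.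
by rewrite -[x]gm_reprK -[y]gm_reprK -rmorphM !gm_map_pi !rmorphM.
Qed.
HB.instance Definition _ := GRing.isZmodMorphism.Build _ _ gm_map gm_mapB.
HB.instance Definition _ := GRing.isMonoidMorphism.Build _ _ gm_map gm_mapM.
Lemma gm_map_of g : gm_map (gm_of A hu g) = gm_of B hu g.
Proof. by rewrite gm_map_pi ga_map_of. Qed.
Lemma gm_map_bar x : gm_map (gm_bar x) = gm_bar (gm_map x).
Proof.
rewrite -[x]gm_reprK gm_bar_pi !gm_map_pi gm_bar_pi; congr gm_pi.
by apply: ga_eqP => g; rewrite !ga_makeE.
Qed.
Lemma gm_map_tr x : gm_tr (gm_map x) = f (gm_tr x).
Proof. by rewrite -[x]gm_reprK gm_map_pi !gm_tr_pi !ga_makeE rmorphB. Qed.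
End BaseChange.

Section Characters.
Variable C : numClosedFieldType.

Lemma prim_root_ex n : (n > 0)%N -> exists z : C, n.-primitive_root z.
Proof.
pose p : {poly C} := 'X^n - 1; have [r Dp] := closed_field_poly_normal p.
move=> n_gt0; rewrite (monicP _) ?monicXnsubC // scale1r in Dp.
have rn1: all n.-unity_root r by apply/allP=> z; rewrite -root_prod_XsubC -Dp.
have sz_r: (n < (size r).+1)%N.
  by rewrite -(size_prod_XsubC r id) -Dp size_XnsubC.
have [|z] := hasP (has_prim_root n_gt0 rn1 _ sz_r); last by exists z.
by rewrite -separable_prod_XsubC -Dp separable_Xn_sub_1 // pnatr_eq0 -lt0n.
Qed.

Variables (G : finZmodType) (m : nat) (om : C).
Hypotheses (hm : #|G| = m.+2) (hom : m.+2.-primitive_root om).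

Definition zchar (k : {ffun G -> 'I_m.+2}) (g : G) : C := om ^+ k g.
Definition is_zchar (k : {ffun G -> 'I_m.+2}) : bool :=
  [forall g, forall h, k (g + h) == k g + k h].

Lemma omD (a b : 'I_m.+2) : om ^+ (a + b)%R = om ^+ a * om ^+ b.
Proof. by rewrite -exprD /= (prim_expr_mod hom). Qed.
Lemma zcharD k g h : is_zchar k -> zchar k (g + h) = zchar k g * zchar k h.
Proof. by move=> /forallP/(_ g)/forallP/(_ h)/eqP; rewrite /zchar => ->; apply: omD. Qed.
Lemma zchar0 k : is_zchar k -> zchar k 0 = 1.
Proof.
move=> /forallP/(_ 0)/forallP/(_ 0)/eqP; rewrite addr0 => /eqP.
by rewrite -subr_eq0 opprD addrA subrr sub0r oppr_eq0 /zchar => /eqP ->.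
Qed.
Lemma zcharDk k k0 g : zchar (k + k0) g = zchar k g * zchar k0 g.
Proof. by rewrite /zchar ffunE omD. Qed.
Lemma is_zcharD k k0 : is_zchar k0 -> is_zchar (k + k0) = is_zchar k.
Proof.
move=> h0; apply/forallP/forallP => hk g; apply/forallP => h; apply/eqP;
  have /forallP/(_ h)/eqP := hk g; have /forallP/(_ g)/forallP/(_ h)/eqP := h0.
  rewrite !ffunE => -> /eqP.
  by rewrite addrACA => /eqP/addIr.
by rewrite !ffunE => -> ->; rewrite addrACA.
Qed.
Lemma zchar_conj k g : is_zchar k -> (zchar k g)^* = zchar k (- g).
Proof.
move=> hk; have h : zchar k g * zchar k (- g) = 1 by rewrite -zcharD // subrr zchar0.
have nz : zchar k g != 0.
  by apply: contra_eq_neq h => ->; rewrite mul0r eq_sym oner_neq0.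
have n1 : `|zchar k g| = 1.
  apply/eqP; rewrite -(@pexpr_eq1 _ _ m.+2) // -normrX -exprM mulnC exprM.
  by rewrite (prim_expr_order hom) expr1n normr1.
by apply: (mulfI nz); rewrite h -normCK n1 expr1n.
Qed.

Lemma zchar_sep (g : G) : g != 0 -> exists2 k, is_zchar k & zchar k g != 1.
Proof.
move=> ng; pose GG := [set: G]%G.
have abG : abelian GG by apply/centsP => x _ y _; apply: addrC.
have [i hi] : exists i : Iirr GG, 'chi_i g != 1.
  apply/existsP; apply: contraNT ng; rewrite negb_exists => /forallP h.
  have : g \in \bigcap_i cfker 'chi[GG]_i.
    apply/bigcapP => i _; rewrite cfkerEirr inE.
    have := h i; rewrite negbK => /eqP ->; apply/eqP/esym.
    by apply: lin_char1; apply: (char_abelianP _ abG).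
  by rewrite TI_cfker_irr => /set1P ->.
have [z hz] := C_prim_root_exists (ltn0Sn m.+1).
have lin := char_abelianP _ abG i.
have un h : 'chi_i h ^+ m.+2 = 1.
  have := order_dvdG (finset.in_setT h : h \in GG); rewrite cardsT hm => /dvdnP[q ->].
  by rewrite mulnC exprM (lin_char_unity_root lin) ?inE // expr1n.
pose k := [ffun h => projT1 (prim_rootP hz (un h))].
have kE h : 'chi_i h = z ^+ k h by rewrite ffunE; case: prim_rootP.
have inj (a b : 'I_m.+2) : z ^+ a = z ^+ b -> a = b.
  move=> /eqP; rewrite (eq_prim_root_expr hz) !modn_small // => /eqP; exact: val_inj.
exists k.
  apply/forallP => a; apply/forallP => b; apply/eqP/inj.
  by rewrite -kE /= (prim_expr_mod hz) exprD -!kE -(lin_charM lin) ?inE.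
apply: contra hi; rewrite /zchar -[1](expr0 om) (eq_prim_root_expr hom) modn_small //.
by rewrite mod0n => /eqP h; rewrite kE h expr0.
Qed.

Definition zsum g := \sum_(k | is_zchar k) zchar k g.
Lemma zsum_neq0 g : g != 0 -> zsum g = 0.
Proof.
move=> /zchar_sep[k0 h0 n1]; have : zsum g * zchar k0 g = zsum g.
  rewrite /zsum mulr_suml [RHS](reindex_inj (addIr k0)) /=.
  by apply: eq_big => [k|k _]; rewrite ?is_zcharD ?zcharDk.
move=> /eqP; rewrite -subr_eq0 -{2}[zsum g]mulr1 -mulrBr mulf_eq0 subr_eq0.
by rewrite (negPf n1) orbF => /eqP.
Qed.
Definition zN := #|[pred k | is_zchar k]|.
Lemma zsum0 : zsum 0 = zN%:R.
Proof.
by rewrite /zsum (eq_bigr (fun=> 1)) ?sumr_const // => k /zchar0.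
Qed.
Lemma zN_gt0 : (0 < zN)%N.
Proof.
apply/card_gt0P; exists [ffun=> 0]; rewrite inE.
by apply/forallP => g; apply/forallP => h; rewrite !ffunE addr0.
Qed.

Variables (u : G) (hu : #[u]%g = 2%N).
Local Notation QG := (grpmod rat hu).

Section Eval.
Variable k : {ffun G -> 'I_m.+2}.
Hypothesis (hk : is_zchar k).
Definition ga_eval of m.+2.-primitive_root om & is_zchar k := fun a : grpalg rat G =>
  \sum_g ratr (ga_coef a g) * zchar k g.
Lemma ga_evalB : zmod_morphism (ga_eval hom hk).
Proof.
move=> a b; rewrite -sumrB; apply: eq_bigr => g _.
by rewrite ga_coefD ga_coefN rmorphB mulrBl.
Qed.
Lemma ga_eval_of g : ga_eval hom hk (ga_of _ g) = zchar k g.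
Proof.
rewrite /ga_eval (bigD1 g) //= ga_makeE eqxx rmorph1 mul1r big1 ?addr0 // => h nh.
by rewrite ga_makeE (negPf nh) rmorph0 mul0r.
Qed.
Lemma ga_evalM : monoid_morphism (ga_eval hom hk).
Proof.
split=> [|a b]; first by rewrite -ga_of0 ga_eval_of zchar0.
rewrite /ga_eval.
under eq_bigr do rewrite ga_coefM rmorph_sum mulr_suml.
rewrite exchange_big mulr_suml; apply: eq_bigr => g _.
rewrite mulr_sumr (reindex_inj (addIr g)); apply: eq_bigr => h _ /=.
by rewrite addrK rmorphM zcharD //; ring.
Qed.
HB.instance Definition _ := GRing.isZmodMorphism.Build _ _ (ga_eval hom hk) ga_evalB.
HB.instance Definition _ := GRing.isMonoidMorphism.Build _ _ (ga_eval hom hk) ga_evalM.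
Hypothesis (hku : zchar k u = -1).
Definition gm_eval of zchar k u = -1 := fun x : QG => ga_eval hom hk (gm_repr x).
Lemma gm_eval_pi a : gm_eval hku (gm_pi hu a) = ga_eval hom hk a.
Proof.
by have := @gm_lift _ _ _ hu _ (ga_eval hom hk) a; apply; rewrite -hku; apply: ga_eval_of.
Qed.
Lemma gm_evalB : zmod_morphism (gm_eval hku).
Proof.
by move=> x y; rewrite -[x]gm_reprK -[y]gm_reprK -rmorphB !gm_eval_pi rmorphB.
Qed.
Lemma gm_evalM : monoid_morphism (gm_eval hku).
Proof.
split=> [|x y]; first by rewrite -(rmorph1 (gm_pi hu)) gm_eval_pi rmorph1.
by rewrite -[x]gm_reprK -[y]gm_reprK -rmorphM !gm_eval_pi rmorphM.
Qed.
HB.instance Definition _ := GRing.isZmodMorphism.Build _ _ (gm_eval hku) gm_evalB.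
HB.instance Definition _ := GRing.isMonoidMorphism.Build _ _ (gm_eval hku) gm_evalM.
Lemma gm_eval_bar x : gm_eval hku (gm_bar x) = (gm_eval hku x)^*.
Proof.
rewrite -[x]gm_reprK gm_bar_pi !gm_eval_pi /ga_eval rmorph_sum.
rewrite (reindex_inj oppr_inj); apply: eq_bigr => g _ /=.
rewrite ga_barE opprK -zchar_conj // rmorphM; congr (_ * _).
by rewrite fmorph_rat.
Qed.
End Eval.

Lemma zformula (x : QG) :
  zN%:R * ratr (gm_tr x) =
  \sum_(k | is_zchar k && (zchar k u == -1))
    (\sum_g ratr (ga_coef (gm_repr x) g) * zchar k g) *+ 2.
Proof.
have [nu uu] := order2P hu.
rewrite [RHS](eq_bigl (fun k => is_zchar k && (zchar k u == -1))) // big_mkcondr /=.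
transitivity (\sum_(k | is_zchar k) (\sum_g ratr (ga_coef (gm_repr x) g) * zchar k g)
  * (1 - zchar k u)); last first.
  apply: eq_bigr => k hk; have : zchar k u ^+ 2 == 1.
    by rewrite expr2 -zcharD // uu zchar0.
  rewrite sqrf_eq1 => /orP[] /eqP ->.
    by rewrite subrr mulr0 ifN // -subr_eq0 opprK -mulr2n pnatr_eq0.
  by rewrite eqxx opprK -mulr2n mulr_natr.
transitivity (\sum_g ratr (ga_coef (gm_repr x) g) * (zsum g - zsum (g + u))).
  rewrite (bigD1 0) // (bigD1 u) //= add0r uu !(zsum_neq0 nu) zsum0 subr0 sub0r.
  rewrite big1 => [|g /andP[n0 n1]].
    by rewrite /gm_tr rmorphB; ring.
  by rewrite !zsum_neq0 ?subr0 ?mulr0 // addr_eq0 oppu.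
under [RHS]eq_bigr do rewrite mulr_suml.
rewrite exchange_big /=; apply: eq_bigr => g _.
rewrite -sumrB mulr_sumr; apply: eq_bigr => k hk.
by rewrite zcharD //; ring.
Qed.
End Characters.

Section Separation.
Variables (C : numClosedFieldType) (G : finZmodType) (u : G) (hu : #[u]%g = 2%N).
Local Notation QG := (grpmod rat hu).

Lemma tr_formula : exists (N : nat) (I : finType) (P : pred I) (F : I -> QG -> C),
  [/\ (0 < N)%N, forall x, N%:R * ratr (gm_tr x) = \sum_(i | P i) F i x *+ 2 &
   forall i, P i -> exists psi : {rmorphism QG -> C},
     F i =1 psi /\ forall x, psi (gm_bar x) = (psi x)^*].
Proof.
have [m hm] : exists m, #|G| = m.+2.
  have [nu _] := order2P hu; case e : #|G| => [|[|m]]; last by exists m.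
    by move: (max_card (pred1 u)); rewrite e card1.
  by move: (max_card (pred2 u 0)); rewrite e card2 nu.
have [om hom] := prim_root_ex C (ltn0Sn m.+1).
exists (zN G m), {ffun G -> 'I_m.+2}, (fun k => is_zchar k && (zchar om k u == -1)).
exists (fun k x => \sum_g ratr (ga_coef (gm_repr x) g) * zchar om k g).
split; [exact: zN_gt0|exact: zformula|].
move=> k /andP[hk /eqP hku]; exists (gm_eval hom (hu:=hu) hk hku).
by split=> // x; apply: gm_eval_bar.
Qed.

Lemma gm_unitQ (n : nat) : n.+1%:R \is a @GRing.unit QG.
Proof.
apply/unitrPr; exists ((n.+1%:R^-1 : rat) *: 1).
by rewrite mulr_natl -scaler_nat scalerA divff ?scale1r // pnatr_eq0.
Qed.

Lemma gm_sep (x : QG) : (forall psi : {rmorphism QG -> C},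
    (forall y, psi (gm_bar y) = (psi y)^*) -> psi x = 0) -> x = 0.
Proof.
move=> h; have [N [I [P [F [N0 FE hF]]]]] := tr_formula.
apply: gm_tr_nondeg; last exact: gm_unitQ.
move=> g; have := FE (gm_of _ hu g * x); rewrite big1 => [|i Pi].
  move=> /eqP; rewrite mulf_eq0 pnatr_eq0 -(rmorph0 (@ratr C)).
  by case: N N0 {FE} => //= N _ /eqP/(fmorph_inj (@ratr C)).
by have [psi [-> hb]] := hF _ Pi; rewrite rmorphM h // mulr0 mul0rn.
Qed.

Lemma gm_algebraic (w : QG) : exists2 p : {poly rat}, p != 0 & horner_alg w p = 0.
Proof.
pose N := #|G|; pose a := gm_repr w.
pose M : 'M[rat]_(N.+1, N) := \matrix_(i, j) ga_coef (a ^+ i) (enum_val j).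
have : kermx M != 0.
  by rewrite kermx_eq0 /row_free neq_ltn ltnS rank_leq_col.
move=> /matrix0Pn [i [j nz]]; pose v := row i (kermx M).
have vM : v *m M = 0 by rewrite -row_mul mulmx_ker row0.
exists (\poly_(l < N.+1) (v 0 (inord l))).
  apply/eqP => /(congr1 (fun p : {poly rat} => p`_j)); rewrite coef_poly coef0 ltn_ord.
  by rewrite inord_val mxE; apply/eqP.
rewrite /horner_alg /horner_morph.
rewrite poly_def rmorph_sum horner_sum /=.
transitivity (gm_pi hu (\sum_(l < N.+1) v 0 l *: a ^+ l)).
  rewrite rmorph_sum; apply: eq_bigr => l _; rewrite /= gm_piZ rmorphXn /= gm_reprK.
  by rewrite linearZ /= map_polyXn hornerZ hornerXn inord_val mulr_algl.
rewrite (_ : \sum_(_ < _) _ = 0) ?rmorph0 //; apply: ga_eqP => g.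
rewrite ga_coef_sum ga_coef0.
have /(congr1 (fun A : 'rV_N => A 0 (enum_rank g))) := vM.
rewrite mxE [RHS]mxE => e; rewrite -[RHS]e.
by apply: eq_bigr => l _; rewrite [M _ _]mxE ga_coefZ enum_rankK.
Qed.

Lemma gm_unit_sep (w : QG) : (forall psi : {rmorphism QG -> C}, psi w != 0) ->
  w \is a GRing.unit.
Proof.
move=> h; have [p p0 pw] := gm_algebraic w.
have [n [q nq pE]] := multiplicity_XsubC p 0.
move: nq; rewrite p0 /= => nq.
have qw : horner_alg w q = 0.
  apply: gm_sep => psi _; move: pw; rewrite pE subr0 rmorphM rmorphXn /=.
  rewrite horner_algX => /(congr1 psi) /eqP; rewrite rmorph0 rmorphM rmorphXn /=.
  by rewrite mulf_eq0 [X in _ || X]expf_eq0 (negPf (h psi)) andbF orbF => /eqP.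
have [r qE] : exists r : {poly rat}, q = r * 'X + (q.[0])%:P.
  exists (q %/ 'X); rewrite {1}(divp_eq q 'X); congr (_ + _).
  by rewrite -['X]subr0 modp_XsubC.
move: qw; rewrite {1}qE rmorphD rmorphM /= horner_algX horner_algC => /eqP.
rewrite addr_eq0 => /eqP e; apply/unitrPr.
exists ((- q.[0]^-1) *: horner_alg w r).
rewrite -scalerAr [w * _]mulrC e scaleNr scalerN opprK scalerA mulVf ?scale1r //.
Qed.

Variable w : QG.
Hypothesis wpos : forall psi : {rmorphism QG -> C}, 0 < psi w.
Lemma pos_unit : w \is a GRing.unit.
Proof. by apply: gm_unit_sep => psi; rewrite gt_eqF. Qed.
Lemma pos_bar : gm_bar w = w.
Proof.
apply/eqP; rewrite -subr_eq0; apply/eqP/gm_sep => psi hb.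
by rewrite rmorphB hb conj_Creal ?subrr // gtr0_real.
Qed.
Lemma pos_tr x : x != 0 -> 0 < gm_tr (x * gm_bar x / w).
Proof.
move=> nx; have [N [I [P [F [N0 FE hF]]]]] := tr_formula.
rewrite -(ltr0q C) -(pmulr_rgt0 _ (_ : 0 < N%:R)) ?ltr0n // FE.
have FF i : P i -> exists psi : {rmorphism QG -> C}, F i =1 psi /\
    F i (x * gm_bar x / w) = `|psi x| ^+ 2 / psi w.
  move=> /hF[psi [h hb]]; exists psi; split=> //.
  by rewrite h !rmorphM rmorphV ?pos_unit //= hb normCK.
have F0 i : P i -> 0 <= F i (x * gm_bar x / w) *+ 2.
  by move=> /FF[psi [_ ->]]; rewrite mulrn_wge0 // divr_ge0 ?exprn_ge0 // ltW.
rewrite lt_def sumr_ge0 // andbT; apply: contraNneq nx => /eqP.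
rewrite psumr_eq0 // => /allP h; apply/eqP.
apply: gm_tr_nondeg; last exact: gm_unitQ.
move=> g; have := FE (gm_of _ hu g * x); rewrite big1 => [|i Pi].
  move=> /eqP; rewrite mulf_eq0 pnatr_eq0 -(rmorph0 (@ratr C)).
  by case: N N0 {FE} => //= N _ /eqP/(fmorph_inj (@ratr C)).
have [psi [E1 E2]] := FF _ Pi; have := h i (mem_index_enum _).
rewrite Pi E2 /= mulrn_eq0 /= mulf_eq0 invr_eq0 (gt_eqF (wpos psi)) orbF expf_eq0 /= normr_eq0.
by move=> /eqP h0; rewrite E1 rmorphM h0 mulr0 mul0rn.
Qed.
End Separation.

Local Open Scope classical_set_scope.

Section Lattices.
Variables (G : finZmodType) (u : G).

Record Glattice := MkGlattice {
  gl_sort :> zmodType;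
  gl_form : gl_sort -> gl_sort -> int;
  gl_act : G -> gl_sort -> gl_sort;
  gl_fg : exists (n : nat) (e : 'I_n -> gl_sort),
    forall x, exists a : 'I_n -> int, x = \sum_i e i *~ a i;
  gl_formDl : forall x y z, gl_form (x + y) z = gl_form x z + gl_form y z;
  gl_formDr : forall x y z, gl_form x (y + z) = gl_form x y + gl_form x z;
  gl_formC : forall x y, gl_form x y = gl_form y x;
  gl_form_gt0 : forall x, x != 0 -> 0 < gl_form x x;
  gl_actD : forall g x y, gl_act g (x + y) = gl_act g x + gl_act g y;
  gl_act_form : forall g x y, gl_form (gl_act g x) (gl_act g y) = gl_form x y;
  gl_act0 : forall x, gl_act 0 x = x;
  gl_actA : forall g h x, gl_act (g + h) x = gl_act g (gl_act h x);
  gl_actu : forall x, gl_act u x = - x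
}.

Definition Giso (L M : Glattice) : set (L -> M) :=
  [set f : L -> M | [/\ bijective f,
               forall x y, f (x + y) = f x + f y,
               forall x y, gl_form (f x) (f y) = gl_form x y &
               forall g x, f (gl_act g x) = gl_act g (f x)]].

Definition Gisomorphic (L M : Glattice) : Prop := exists f : L -> M, Giso f.

Hypothesis hu : #[u]%g = 2%N.
Local Notation ZG := (grpmod int hu).
Local Notation QG := (grpmod rat hu).

Definition ZtoQ : ZG -> QG := gm_map (intmul 1 : {rmorphism int -> rat}) (hu:=hu).
HB.instance Definition _ := GRing.RMorphism.on ZtoQ.

(* Z<G>, as a subset of Q<G>. *)
Definition ZGset : set QG := range ZtoQ.

Record fracideal := MkFracIdeal {
  fi_set :> set QG;
  fi_0 : fi_set 0;
  fi_add : forall x y, fi_set x -> fi_set y -> fi_set (x + y);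
  fi_mul : forall (a : ZG) x, fi_set x -> fi_set (ZtoQ a * x);
  fi_fg : exists (n : nat) (e : 'I_n -> QG), (forall i, fi_set (e i)) /\
    forall x, fi_set x -> exists a : 'I_n -> ZG, x = \sum_i ZtoQ (a i) * e i;
  fi_span : forall x : QG, exists (n : nat) (c : 'I_n -> rat) (y : 'I_n -> QG),
    (forall i, fi_set (y i)) /\ x = \sum_i c i *: y i
}.

Definition set_scale (v : QG) (I : set QG) : set QG := [set v * x | x in I].
Definition set_bar (I : set QG) : set QG := [set gm_bar x | x in I].
Definition set_prod (I J : set QG) : set QG :=
  [set z | exists (n : nat) (x y : 'I_n -> QG),
    [/\ forall i, I (x i), forall i, J (y i) & z = \sum_i x i * y i]].

Definition fi_pred (I : fracideal) : {pred QG} := fun x => `[< fi_set I x >].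
Fact fi_pred_zmod I : zmod_closed (fi_pred I).
Proof.
split=> [|x y /asboolP Ix /asboolP Iy]; apply/asboolP; first exact: fi_0.
have := fi_add Ix (fi_mul (-1) Iy).
by rewrite rmorphN1 mulN1r.
Qed.
HB.instance Definition _ I := GRing.isZmodClosed.Build QG (fi_pred I) (fi_pred_zmod I).

Definition fi_type (I : fracideal) : Type := {x : QG | x \in fi_pred I}.
HB.instance Definition _ I := SubChoice.copy (fi_type I) {x : QG | x \in fi_pred I}.
HB.instance Definition _ I := [SubChoice_isSubZmodule of fi_type I by <:].

Definition fi_val (I : fracideal) (x : fi_type I) : QG := val x.

Lemma fi_valP I (x : fi_type I) : fi_set I (fi_val x).
Proof. by apply/asboolP; exact: (valP x). Qed.
Lemma fi_valB I : zmod_morphism (@fi_val I).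
Proof. by []. Qed.
HB.instance Definition _ I :=
  GRing.isZmodMorphism.Build (fi_type I) QG (@fi_val I) (@fi_valB I).
Lemma fi_val_inj I : injective (@fi_val I).
Proof. exact: val_inj. Qed.
Lemma fi_valK I (x : QG) (Ix : fi_set I x) :
  exists y : fi_type I, fi_val y = x.
Proof. by exists (exist _ x (asboolT Ix)). Qed.

Fact std_0 : ZGset 0.
Proof. by exists 0; rewrite ?rmorph0. Qed.
Fact std_add x y : ZGset x -> ZGset y -> ZGset (x + y).
Proof. by move=> [a _ <-] [b _ <-]; exists (a + b); rewrite ?rmorphD. Qed.
Fact std_mul (a : ZG) x : ZGset x -> ZGset (ZtoQ a * x).
Proof. by move=> [b _ <-]; exists (a * b); rewrite ?rmorphM. Qed.
Fact std_fg : exists (n : nat) (e : 'I_n -> QG), (forall i, ZGset (e i)) /\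
    forall x, ZGset x -> exists a : 'I_n -> ZG, x = \sum_i ZtoQ (a i) * e i.
Proof.
exists 1%N, (fun=> 1); split=> [_|x [a _ <-]]; first by exists 1; rewrite ?rmorph1.
by exists (fun=> a); rewrite big_ord1 mulr1.
Qed.
Fact std_span (x : QG) : exists (n : nat) (c : 'I_n -> rat) (y : 'I_n -> QG),
    (forall i, ZGset (y i)) /\ x = \sum_i c i *: y i.
Proof.
exists #|G|, (fun i => ga_coef (gm_repr x) (enum_val i)), (fun i => gm_of _ hu (enum_val i)).
split=> [i|]; first by exists (gm_of _ hu (enum_val i)); rewrite // /ZtoQ gm_map_of.
by rewrite {1}[x]gm_decomp (reindex _ (onW_bij _ (enum_val_bij G))).
Qed.
Definition std_ideal : fracideal :=
  MkFracIdeal std_0 std_add std_mul std_fg std_span.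

Variable R : realType.

Section Lat.
Variables (I : fracideal) (w : QG).
Hypothesis hIw : set_prod I (set_bar I) `<=` [set a * w | a in ZGset].
Hypothesis hw : forall psi : {rmorphism QG -> R[i]}, 0 < psi w.

Let wU : w \is a GRing.unit := pos_unit hw.

(* t(x * bar y / w) is an integer, namely its own numerator: see lat_formE. *)
Definition lat_form (x y : fi_type I) : int :=
  numq (gm_tr (fi_val x * gm_bar (fi_val y) / w)).

Lemma lat_formE x y :
  (lat_form x y)%:~R = gm_tr (fi_val x * gm_bar (fi_val y) / w) :> rat.
Proof.
have [|_ [a _ <-] e] := hIw (_ : set_prod I (set_bar I) (fi_val x * gm_bar (fi_val y))).
  exists 1%N, (fun=> fi_val x), (fun=> gm_bar (fi_val y)).
  split=> [_|_|]; rewrite ?big_ord1 //; first exact: fi_valP.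
  by exists (fi_val y) => //; apply: fi_valP.
by rewrite /lat_form -e mulrK // gm_map_tr /= numq_int.
Qed.

Fact lat_act_in g (x : fi_type I) : gm_of rat hu g * fi_val x \in fi_pred I.
Proof.
apply/asboolP; have := fi_mul (gm_of int hu g) (fi_valP x).
by rewrite /ZtoQ gm_map_of.
Qed.
Definition lat_act (g : G) (x : fi_type I) : fi_type I :=
  exist _ (gm_of rat hu g * fi_val x) (lat_act_in g x).
Lemma lat_actE g x : fi_val (lat_act g x) = gm_of rat hu g * fi_val x.
Proof. by []. Qed.

Fact lat_fg : exists (n : nat) (e : 'I_n -> fi_type I),
    forall x, exists a : 'I_n -> int, x = \sum_i e i *~ a i.
Proof.
have [n [e [eI egen]]] := fi_fg I.
have eE i : exists y : fi_type I, fi_val y = e i := fi_valK (eI i).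
have {eE} /choice[e' e'E] := eE.
pose T : finType := ('I_n * G)%type.
exists #|T|, (fun k => lat_act (enum_val k).2 (e' (enum_val k).1)) => x.
have [a xE] := egen _ (fi_valP x).
exists (fun k => ga_coef (gm_repr (a (enum_val k).1)) (enum_val k).2).
apply: fi_val_inj; rewrite /fi_val raddf_sum [LHS]xE.
rewrite -(@reindex _ _ _ _ _ _ xpredT
  (fun p : T => val (lat_act p.2 (e' p.1) *~ ga_coef (gm_repr (a p.1)) p.2))
  (onW_bij _ (enum_val_bij T))).
rewrite -(pair_big xpredT xpredT
  (fun i g => val (lat_act g (e' i) *~ ga_coef (gm_repr (a i)) g))) /=.
apply: eq_bigr => i _; rewrite {1}[a i]gm_decomp rmorph_sum mulr_suml.
apply: eq_bigr => g _ /=.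
rewrite -[val _]/(fi_val _) raddfMz /= lat_actE e'E.
by rewrite -{1}[ga_coef _ _]intz scaler_int rmorphMz -mulrzAl /= /ZtoQ gm_map_of.
Qed.

Fact lat_formDl x y z : lat_form (x + y) z = lat_form x z + lat_form y z.
Proof.
apply: (@intr_inj rat); rewrite rmorphD /= !lat_formE raddfD.
by rewrite !mulrDl raddfD.
Qed.
Fact lat_formC x y : lat_form x y = lat_form y x.
Proof.
apply: (@intr_inj rat); rewrite !lat_formE -gm_tr_bar.
by rewrite !rmorphM rmorphV //= gm_barK (pos_bar hw) [gm_bar _ * _]mulrC.
Qed.
Fact lat_formDr x y z : lat_form x (y + z) = lat_form x y + lat_form x z.
Proof. by rewrite lat_formC lat_formDl !(lat_formC x). Qed.
Fact lat_form_gt0 x : x != 0 -> 0 < lat_form x x.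
Proof.
move=> nx; rewrite -(ltr0z rat) lat_formE; apply: (pos_tr hw).
by apply: contraNneq nx => h; apply/eqP/fi_val_inj.
Qed.
Fact lat_actD g x y : lat_act g (x + y) = lat_act g x + lat_act g y.
Proof. by apply: fi_val_inj; rewrite raddfD /= !lat_actE raddfD mulrDr. Qed.
Fact lat_act_form g x y : lat_form (lat_act g x) (lat_act g y) = lat_form x y.
Proof.
apply: (@intr_inj rat); rewrite !lat_formE !lat_actE rmorphM /= gm_bar_of.
by rewrite mulrACA -gm_ofD subrr gm_of0 mul1r.
Qed.
Fact lat_act0 x : lat_act 0 x = x.
Proof. by apply: fi_val_inj; rewrite lat_actE gm_of0 mul1r. Qed.
Fact lat_actA g h x : lat_act (g + h) x = lat_act g (lat_act h x).
Proof. by apply: fi_val_inj; rewrite !lat_actE gm_ofD mulrA. Qed.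
Fact lat_actu x : lat_act u x = - x.
Proof. by apply: fi_val_inj; rewrite lat_actE gm_ofu mulN1r. Qed.

(* L_(I,w). *)
Definition lat : Glattice :=
  MkGlattice lat_fg lat_formDl lat_formDr lat_formC lat_form_gt0
    lat_actD lat_act_form lat_act0 lat_actA lat_actu.
End Lat.

Fact std_sub : set_prod std_ideal (set_bar std_ideal) `<=` [set a * 1 | a in ZGset].
Proof.
move=> _ [n [x [y [hx hy ->]]]]; exists (\sum_i x i * y i); last by rewrite mulr1.
elim/big_ind: _ => [||i _]; [exact: std_0|exact: std_add|].
have [a _ <-] := hx i; apply: std_mul.
by have [_ [b _ <-] <-] := hy i; exists (gm_bar b); rewrite // /ZtoQ gm_map_bar.
Qed.
Fact std_pos (psi : {rmorphism QG -> R[i]}) : 0 < psi 1.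
Proof. by rewrite rmorph1 ltr01. Qed.
(* The standard G-lattice L_(Z<G>,1). *)
Definition std_lat : Glattice := lat std_sub std_pos.

(* "Sending v to multiplication by v gives a bijection from V to S".  Outside V
   multiplication by v need not map I2 to I1, so F is constrained only on V. *)
Definition mul_bij (I2 I1 : fracideal) (V : set QG)
    (S : set (fi_type I2 -> fi_type I1)) : Prop :=
  exists F : QG -> fi_type I2 -> fi_type I1,
    (forall v, V v -> forall x, fi_val (F v x) = v * fi_val x) /\ set_bij V S F.

End Lattices.

Arguments ZGset {G u} hu _.
Arguments lat {G u hu R} I w hIw hw.

(* Main.v *)
Require Import Defs.
From HB Require Import structures.
From mathcomp Require Import all_boot all_order all_algebra all_fingroup.
From mathcomp Require Import boolp classical_sets functions reals complex.

Set Implicit Arguments.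
Unset Strict Implicit.
Unset Printing Implicit Defensive.

Import Order.TTheory GRing.Theory Num.Theory.
Local Open Scope ring_scope.
Local Open Scope classical_set_scope.

(** A G-isomorphism [f : L2 -> L1] is Z<G>-linear.  Some positive integer [N]
    lies in [I2], and every element of Q<G> has a positive integer multiple in
    Z<G>; hence [f] is multiplication by [v = f(N) / N].  Evaluating the forms
    at [N g] and [N] gives [t(g v bar(v) / w1) = t(g / w2)] for every [g] in
    [G], and nondegeneracy of the trace form forces [w1 = v bar(v) w2].
    Conversely this relation makes [v] a unit, so multiplication by [v] is an
    isometric bijection from [I2] onto [v I2]. *)

(** The bijections concern maps into [L1], while the final equivalence speaks of maps out of it. *)
Lemma Gisomorphic_sym (G : finZmodType) (u : G) (L M : Glattice u) :
  Gisomorphic L M -> Gisomorphic M L.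
Proof.
move=> [f [[g fK gK] fD fF fA]]; exists g; split; first by exists f.
- by move=> x y; apply: (can_inj fK); rewrite fD !gK.
- by move=> x y; rewrite -fF !gK.
- by move=> h x; apply: (can_inj fK); rewrite fA !gK.
Qed.

Section Denominators.
Variables (G : finZmodType) (u : G) (hu : #[u]%g = 2%N).
Local Notation ZG := (grpmod int hu).
Local Notation QG := (grpmod rat hu).

Lemma common_denominator (I : finType) (c : I -> rat) :
  exists2 N : nat, (0 < N)%N & exists a : I -> int, forall i, c i * N%:R = (a i)%:~R.
Proof.
pose d i := `|denq (c i)|%N.
have dE i : (d i)%:R = (denq (c i))%:~R :> rat.
  by rewrite -[in RHS](gtz0_abs (denq_gt0 (c i))).
exists (\prod_i d i)%N; first by apply: prodn_gt0 => i; rewrite absz_gt0 denq_neq0.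
exists (fun i => numq (c i) * (\prod_(j | j != i) d j)%N%:Z) => i.
rewrite (bigD1 i) //= natrM mulrA dE -{1}[c i]divq_num_den mulfVK ?intr_eq0 ?denq_neq0 //.
by rewrite rmorphM.
Qed.

(** Clear the denominators of the coefficients of a representative of [x] in the group ring. *)
Lemma integral_multiple (x : QG) :
  exists2 N : nat, (0 < N)%N & exists a : ZG, x * N%:R = ZtoQ a.
Proof.
have [N N0 [a aE]] := common_denominator (ga_coef (gm_repr x)).
exists N => //; exists (\sum_g gm_of int hu g *~ a g).
rewrite {1}[x]gm_decomp mulr_suml rmorph_sum; apply: eq_bigr => g _ /=.
rewrite rmorphMz /= /ZtoQ gm_map_of -[RHS]scaler_int -aE mulr_natr -scaler_nat.
by rewrite scalerA mulrC.
Qed.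

Lemma fi_mulz (I : fracideal hu) x (n : int) : fi_set I x -> fi_set I (x *~ n).
Proof. by move=> /(fi_mul n%:~R); rewrite rmorph_int mulrzl. Qed.

(** Clear denominators in an expression of 1 as a rational combination of elements of [I]. Since 1
    itself may lie outside [I], the unit [N] serves as the test element in its place. *)
Lemma fracideal_nat (I : fracideal hu) :
  exists2 N : nat, (0 < N)%N & fi_set I N%:R.
Proof.
have [n [c [y [yI E]]]] := fi_span I 1.
have [N N0 [a aE]] := common_denominator c; exists N => //.
rewrite -[N%:R]mul1r {1}E mulr_suml; elim/big_ind: _ => [||i _].
- exact: fi_0.
- exact: fi_add.
- rewrite mulr_natr -scaler_nat scalerA mulrC aE scaler_int; exact: fi_mulz.
Qed.

Lemma natQG_unit (N : nat) : (0 < N)%N -> N%:R \is a @GRing.unit QG.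
Proof. by case: N => // N _; exact: gm_unitQ. Qed.

End Denominators.

Section Isomorphisms.
Variables (R : realType) (G : finZmodType) (u : G) (hu : #[u]%g = 2%N).
Local Notation ZG := (grpmod int hu).
Local Notation QG := (grpmod rat hu).

Section Linearity.
Variables (I1 I2 : fracideal hu) (f : fi_type I2 -> fi_type I1).
Hypothesis fD : {morph f : x y / x + y}.
Hypothesis fA : forall g x, f (lat_act g x) = lat_act g (f x).

(** [a] is an integer combination of group elements, and the additive map [f] commutes with each of
    them. [fi_type] carries only its additive structure, so the product of [a] and [x] enters as an
    element [y] with the right value in Q<G>. *)
Lemma equivariant_linear (a : ZG) x y :
  fi_val y = ZtoQ a * fi_val x -> fi_val (f y) = ZtoQ a * fi_val (f x).
Proof.
have fB : zmod_morphism f.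
  by move=> s t; apply: (addIr (f t)); rewrite -fD !subrK.
pose F := HB.pack_for {additive fi_type I2 -> fi_type I1} f
  (GRing.isZmodMorphism.Build _ _ f fB).
move=> yE.
have {yE} -> : y = \sum_g lat_act g x *~ ga_coef (gm_repr a) g.
  apply: fi_val_inj; rewrite yE [in LHS](gm_decomp a) raddf_sum mulr_suml raddf_sum.
  apply: eq_bigr => g _ /=; rewrite raddfMz /= lat_actE -{1}[ga_coef _ _]intz.
  by rewrite scaler_int rmorphMz /= /ZtoQ gm_map_of mulrzAl.
rewrite -[f _]/(F _) !raddf_sum [in RHS](gm_decomp a) raddf_sum mulr_suml.
apply: eq_bigr => g _; rewrite raddfMz /= raddfMz /= fA lat_actE -{2}[ga_coef _ _]intz.
by rewrite scaler_int rmorphMz /= /ZtoQ gm_map_of mulrzAl.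
Qed.

Lemma equivariant_mul : exists v : QG, forall x, fi_val (f x) = v * fi_val x.
Proof.
have [N N0 IN] := fracideal_nat I2; have [e eE] := fi_valK IN.
have NU := natQG_unit hu N0.
exists (fi_val (f e) / N%:R) => x.
have [M M0 [a aE]] := integral_multiple (fi_val x).
have MU := natQG_unit hu M0.
(* The element [M * N * x] equals [a * e], because [M * x = a] and [e = N]. Linearity thus computes
   its image in two ways, and cancelling the units [M] and [N] isolates [f x]. *)
have h1 : fi_val (f (x *+ (M * N))) = ZtoQ a * fi_val (f e).
  by apply: equivariant_linear; rewrite raddfMn /= eE -aE -mulrA -natrM mulr_natr.
have h2 : fi_val (f (x *+ (M * N))) = ZtoQ (M * N)%:R * fi_val (f x).
  by apply: equivariant_linear; rewrite raddfMn /= rmorph_nat mulr_natl.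
apply: (mulrI NU); apply: (mulrI MU).
rewrite mulrA -natrM -(rmorph_nat (@ZtoQ _ _ hu)) -h2 h1 -aE.
by rewrite [N%:R * _]mulrA [N%:R * _]mulrC mulrVK // [M%:R * _]mulrC -[RHS]mulrA [RHS]mulrC.
Qed.

End Linearity.

(** It suffices to compare at the unit [N] in [I]; this yields injectivity of the map sending [v] to
    multiplication by [v]. *)
Lemma fi_scale_inj (I : fracideal hu) (v v' : QG) :
  (forall x, fi_set I x -> v * x = v' * x) -> v = v'.
Proof.
have [N N0 IN] := fracideal_nat I => /(_ _ IN).
exact/mulIr/natQG_unit.
Qed.

(** The pairs [x = g * N], [y = N] suffice: the involution fixes [N], so nondegeneracy gives
    [N * (N * a) = N * (N * b)], and [N] is a unit. *)
Lemma trace_form_inj (I : fracideal hu) (a b : QG) :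
  (forall x y, fi_set I x -> fi_set I y ->
     gm_tr (x * gm_bar y * a) = gm_tr (x * gm_bar y * b)) -> a = b.
Proof.
move=> h; have [N N0 IN] := fracideal_nat I.
have NU := natQG_unit hu N0.
apply: (mulrI NU); apply: (mulrI NU); apply/eqP; rewrite -subr_eq0; apply/eqP.
apply: gm_tr_nondeg; last exact: gm_unitQ.
move=> g; apply/eqP; rewrite mulrBr raddfB subr_eq0; apply/eqP.
have := h (gm_of rat hu g * N%:R) N%:R; rewrite rmorph_nat -!mulrA; apply=> //.
by have := fi_mul (gm_of int hu g) IN; rewrite /ZtoQ gm_map_of.
Qed.

Variables (I1 I2 : fracideal hu) (w1 w2 : QG).
Hypothesis hIw1 : set_prod I1 (set_bar I1) `<=` [set a * w1 | a in ZGset hu].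
Hypothesis hIw2 : set_prod I2 (set_bar I2) `<=` [set a * w2 | a in ZGset hu].
Hypothesis hw1 : forall psi : {rmorphism QG -> R[i]}, 0 < psi w1.
Hypothesis hw2 : forall psi : {rmorphism QG -> R[i]}, 0 < psi w2.
Let L1 := lat I1 w1 hIw1 hw1.
Let L2 := lat I2 w2 hIw2 hw2.

Lemma Giso_mul (f : L2 -> L1) : Giso f ->
  exists v : QG, [/\ forall x, fi_val (f x) = v * fi_val x,
    fi_set I1 = set_scale v I2 & w1 = v * gm_bar v * w2].
Proof.
have w1U := pos_unit hw1; have w2U := pos_unit hw2.
move=> [[g fK gK] fD fF fA]; have [v fv] := equivariant_mul fD fA.
exists v; split=> //.
  apply/seteqP; split=> [x /fi_valK[y <-]|_ [x /fi_valK[y <-] <-]].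
    by exists (fi_val (g y)); [exact: fi_valP|rewrite -fv gK].
  by rewrite -fv; exact: fi_valP.
(* Preservation of the forms says that [x * gm_bar y] has the same trace against both sides, for all
   [x] and [y] in [I2]. *)
have e : v * gm_bar v / w1 = w2^-1.
  apply: (trace_form_inj (I := I2)) => _ _ /fi_valK[x <-] /fi_valK[y <-].
  rewrite -(lat_formE hIw2 hw2) -[lat_form _ _ _]/(@gl_form _ _ L2 x y) -fF.
  rewrite (lat_formE hIw1 hw1) !fv rmorphM /=; congr gm_tr.
  by rewrite mulrA; congr (_ / _); rewrite [RHS]mulrACA mulrC.
by rewrite -[v * gm_bar v](mulrVK w1U) e mulrAC mulVr ?mul1r.
Qed.

Lemma mul_Giso (v : QG) (f : L2 -> L1) : fi_set I1 = set_scale v I2 ->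
  w1 = v * gm_bar v * w2 -> (forall x, fi_val (f x) = v * fi_val x) -> Giso f.
Proof.
have w1U := pos_unit hw1; have w2U := pos_unit hw2.
(* [v] is a factor of the unit [w1] in a commutative ring. *)
move=> I1E w1E fv; have vU : v \is a GRing.unit.
  by move: w1U; rewrite w1E !unitrM => /andP[/andP[]].
have bU : gm_bar v \is a GRing.unit by apply: rmorph_unit.
split.
(* The inverse of [f] is division by [v], which carries [I1 = v I2] back into [I2]. *)
- have h (y : L1) : exists x : L2, fi_val x = v^-1 * fi_val y.
    have := fi_valP y; rewrite I1E => -[x xI <-].
    by rewrite mulKr //; exact: fi_valK.
  have [g gE] := choice h; exists g => x; apply: fi_val_inj.
    by rewrite gE fv mulKr.
  by rewrite fv gE mulVKr.
- by move=> x y; apply: fi_val_inj; rewrite raddfD /= !fv raddfD mulrDr.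
- move=> x y; apply: (@intr_inj rat).
  rewrite (lat_formE hIw1 hw1) (lat_formE hIw2 hw2) !fv rmorphM /=; congr gm_tr.
  rewrite mulrACA w1E invrM ?unitrM ?vU //.
  by rewrite [v * gm_bar v * _]mulrC mulrACA divrr ?unitrM ?vU // mulr1.
- by move=> g x; apply: fi_val_inj; rewrite fv !lat_actE fv mulrCA.
Qed.

Lemma mul_bij_Giso :
  mul_bij [set v | fi_set I1 = set_scale v I2 /\ w1 = v * gm_bar v * w2]
    (@Giso G u L2 L1).
Proof.
have h (v : QG) : exists f : fi_type I2 -> fi_type I1,
    fi_set I1 = set_scale v I2 -> forall x, fi_val (f x) = v * fi_val x.
  (* When [I1] differs from [v I2], the product may leave [I1], so the zero map is the default
     value. *)
  case: (pselect (fi_set I1 = set_scale v I2)) => [I1E|nI]; last by exists (fun=> 0).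
  suff /choice[f fE] : forall x : fi_type I2, exists y : fi_type I1, fi_val y = v * fi_val x.
    by exists f.
  by move=> x; apply: fi_valK; rewrite I1E; exists (fi_val x) => //; exact: fi_valP.
have [F FE] := choice h; exists F; split=> [v [/FE]//|]; split.
- by move=> v [I1E w1E]; apply: (mul_Giso I1E w1E); exact: FE.
- move=> v v' /set_mem[I1E _] /set_mem[I1E' _] FF.
  by apply: (fi_scale_inj (I := I2)) => _ /fi_valK[x <-]; rewrite -!FE // FF.
- move=> f /Giso_mul[v [fv I1E w1E]]; exists v => //.
  by apply/funext => x; apply: fi_val_inj; rewrite FE // fv.
Qed.

End Isomorphisms.

Theorem theorem8p5 (R : realType) (G : finZmodType) (u : G) (hu : #[u]%g = 2%N)
    (I1 I2 : fracideal hu) (w1 w2 : grpmod rat hu)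
    (hIw1 : set_prod I1 (set_bar I1) `<=` [set a * w1 | a in ZGset hu])
    (hIw2 : set_prod I2 (set_bar I2) `<=` [set a * w2 | a in ZGset hu])
    (hw1 : forall psi : {rmorphism grpmod rat hu -> R[i]}, 0 < psi w1)
    (hw2 : forall psi : {rmorphism grpmod rat hu -> R[i]}, 0 < psi w2) :
  let L1 := lat I1 w1 hIw1 hw1 in
  let L2 := lat I2 w2 hIw2 hw2 in
  let ZL := std_lat hu R in
  [/\ mul_bij
        [set v | fi_set I1 = set_scale v I2 /\ w1 = v * gm_bar v * w2]
        (@Giso G u L2 L1),
      mul_bij
        [set v | fi_set I1 = set_scale v (ZGset hu) /\ w1 = v * gm_bar v]
        (@Giso G u ZL L1) &
      Gisomorphic L1 ZL <->
      exists v : grpmod rat hu,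
        fi_set I1 = set_scale v (ZGset hu) /\ w1 = v * gm_bar v].
Proof.
move=> L1 L2 ZL.
have std : mul_bij
    [set v | fi_set I1 = set_scale v (ZGset hu) /\ w1 = v * gm_bar v]
    (@Giso G u ZL L1).
  (* The standard lattice is the case of the ideal Z<G> with [w2 = 1], whose factor then drops
     out. *)
  have := mul_bij_Giso hIw1 (@std_sub G u hu) hw1 (@std_pos G u hu R).
  by under eq_set do rewrite mulr1.
split=> //; first exact: mul_bij_Giso.
have [F [_ [Fiso _ Fsurj]]] := std.
split=> [/Gisomorphic_sym[f /Fsurj[v Vv _]]|[v Vv]]; first by exists v.
by apply: Gisomorphic_sym; exists (F v); exact: Fiso.
Qed.
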